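(* In the decentralized setting, consider the agents' hitting costs $\{f_t^i\}_{i,t}$ to be $\mu_i$-strongly convex and the switching costs to be squared $\ell_2$-norm. Further, consider any dissimilarity cost that is convex in the actions. For weight $\beta>0$ on the dissimilarity cost, the competitive ratio of any online algorithm ALG is lower bounded as $$\mathrm{CR}_{\mathrm{ALG}}\;\ge\;\frac12+\frac12\sqrt{1+\frac{4}{\min_i\mu_i}}=\mathrm{CR}_*,$$ with no helping effect from the dissimilarity cost.
   Context: There are $N$ agents and rounds $t=1,\dots,T$. In round $t$ agent $i$ receives online a $\mu_i$-strongly convex hitting cost $f_t^i$ and in response takes an action $x_t^i\in\mathbb{R}^d$. The agents are coupled through an undirected graph $\mathcal G_t=([N],\mathcal E_t)$, which may change adaptively and adversarially with $t$ and need not be connected; in the decentralized setting agents interact only with their immediate neighbours in $\mathcal G_t$. The cumulative cost of a sequence $\mathbf x_t=(x_t^1,\dots,x_t^N)$, $t=1,\dots,T$, is the sum over all rounds of the hitting costs $\sum_i f_t^i(x_t^i)$, the switching costs $\sum_i\frac12\|x_t^i-x_{t-1}^i\|_2^2$, and the dissimilarity cost with weight $\beta$. A dissimilarity cost is an additional cost by which coupled agents are penalized for the mismatch between their actions; the basic example is $\frac{\beta}{2}\sum_{(i,j)\in\mathcal E_t}\|A_t^{(i,j)}x_t^i-A_t^{(i,j)}x_t^j\|_2^2$ with full-rank matrices $A_t^{(i,j)}\in\mathbb{R}^{r_t\times d}$, $r_t\ge d$. OPT denotes the hindsight optimal sequence of actions, which minimizes the cumulative cost offline. An online algorithm ALG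 has (asymptotic) competitive ratio $\mathrm{CR}_{\mathrm{ALG}}$ if for all problem instances $\mathrm{Cost}_{\mathrm{ALG}}[1,T]\le\mathrm{CR}_{\mathrm{ALG}}\cdot\mathrm{Cost}_{\mathrm{OPT}}[1,T]+o(1)$, where the $o(1)$ term converges to $0$ as $T\to\infty$ and its constants are instance-independent. *)

(* Defs.v *)
From HB Require Import structures.
From mathcomp Require Import all_boot all_order all_algebra.
From mathcomp Require Import all_classical all_reals all_analysis.
Set Implicit Arguments.
Unset Strict Implicit.
Unset Printing Implicit Defensive.
Import Order.TTheory GRing.Theory Num.Theory.
Import numFieldNormedType.Exports.
Local Open Scope classical_set_scope.
Local Open Scope ring_scope.

(* The squared Euclidean norm; the library norm on ['rV[R]_d] is the sup norm. *)
Definition sqnorm2 (R : realType) (d : nat) (v : 'rV[R]_d) : R :=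
  \sum_(k < d) v 0 k ^+ 2.

Definition strongly_convex (R : realType) (d : nat) (m : R)
    (f : 'rV[R]_d -> R) : Prop :=
  forall (x y : 'rV[R]_d) (p : R), 0 <= p <= 1 ->
    f (p *: x + (1 - p) *: y) <=
      p * f x + (1 - p) * f y - m / 2 * (p * (1 - p)) * sqnorm2 (x - y).

Definition undirected_graph (N : nat) (G : rel 'I_N) : Prop :=
  symmetric G /\ irreflexive G.

(* An action profile is a matrix ['M[R]_(N, d)] whose row [i] is the action of
   agent [i]. A dissimilarity cost on [G] is a penalty for the mismatch between
   agents coupled by [G]: nonnegative, and null when no two neighbours differ. *)
Definition dissimilarity_cost (R : realType) (N d : nat) (G : rel 'I_N)
    (s : 'M[R]_(N, d) -> R) : Prop :=
  (forall x, 0 <= s x) /\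
  (forall x, (forall i j, G i j -> row i x = row j x) -> s x = 0).

Definition convex_cost (R : realType) (N d : nat)
    (s : 'M[R]_(N, d) -> R) : Prop :=
  convex_function (E := 'M[R]_(N, d)) [set: 'M[R]_(N, d)] s.

(* [dissimilarity] carries no weight: the factor [beta] is applied in [cost]. *)
Record round (R : realType) (N d : nat) := Round {
  hitting : 'I_N -> 'rV[R]_d -> R ;
  graph : rel 'I_N ;
  dissimilarity : 'M[R]_(N, d) -> R }.

(* [Dis t G] is the set of dissimilarity costs which may be revealed in round [t]
   when the graph is [G]. For the sum over the edges (i, j) of G of
   2^-1 * |A_ij x_i - A_ij x_j|^2, it is the set of these functions for all
   choices of the full-rank matrices A_ij. *)
Definition dissimilarity_model (R : realType) (N d : nat) :=
  nat -> rel 'I_N -> set ('M[R]_(N, d) -> R).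

(* The rounds of an instance of horizon [T] are those of indices 1, ..., T. *)
Definition is_instance (R : realType) (N d : nat) (mu : 'I_N -> R)
    (Dis : dissimilarity_model R N d) (T : nat) (I : nat -> round R N d) : Prop :=
  forall t, (1 <= t <= T)%N ->
    [/\ forall i x, 0 <= hitting (I t) i x,
        forall i, strongly_convex (mu i) (hitting (I t) i),
        undirected_graph (graph (I t)) &
        Dis t (graph (I t)) (dissimilarity (I t))].

Definition cost (R : realType) (N d : nat) (beta : R) (T : nat)
    (I : nat -> round R N d) (x : nat -> 'M[R]_(N, d)) : R :=
  \sum_(1 <= t < T.+1)
    (\sum_(i < N) hitting (I t) i (row i (x t))
     + \sum_(i < N) 2^-1 * sqnorm2 (row i (x t) - row i (x t.-1))
     + beta * dissimilarity (I t) (x t)).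

(* The cost of the hindsight optimal sequence starting from [x0]. *)
Definition opt_cost (R : realType) (N d : nat) (beta : R)
    (x0 : 'M[R]_(N, d)) (T : nat) (I : nat -> round R N d) : R :=
  inf [set cost beta T I x | x in [set x : nat -> 'M[R]_(N, d) | x 0%N = x0]].

(* An online algorithm maps the horizon (which it is thus allowed to know) and
   the rounds revealed so far, the current one included, to the current action
   profile. No locality is imposed: decentralized algorithms, in which the
   action of an agent only uses the information that reached it along the edges
   of the successive graphs, are particular cases. *)
Definition online_algorithm (R : realType) (N d : nat) :=
  nat -> seq (round R N d) -> 'M[R]_(N, d).

Definition trajectory (R : realType) (N d : nat) (ALG : online_algorithm R N d)
    (x0 : 'M[R]_(N, d)) (T : nat) (I : nat -> round R N d) (t : nat) :
    'M[R]_(N, d) :=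
  if t is 0%N then x0 else ALG T [seq I s | s <- iota 1 t].

(* The additive term [eps] depends on the horizon but not on the instance. *)
Definition has_competitive_ratio (R : realType) (N d : nat) (mu : 'I_N -> R)
    (beta : R) (Dis : dissimilarity_model R N d) (x0 : 'M[R]_(N, d))
    (ALG : online_algorithm R N d) (c : R) : Prop :=
  exists eps : nat -> R, eps @ \oo --> (0 : R) /\
    forall (T : nat) (I : nat -> round R N d), is_instance mu Dis T I ->
      cost beta T I (trajectory ALG x0 T I) <= c * opt_cost beta x0 T I + eps T.

(* Main.v *)
Require Import Defs.
From HB Require Import structures.
From mathcomp Require Import all_boot all_order all_algebra.
From mathcomp Require Import all_classical all_reals all_analysis.
From mathcomp Require Import ring lra.
Set Implicit Arguments.
Unset Strict Implicit.
Unset Printing Implicit Defensive.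
Import Order.TTheory GRing.Theory Num.Theory.
Import numFieldNormedType.Exports.
Local Open Scope classical_set_scope.
Local Open Scope ring_scope.

(** The dissimilarity cost does not help because the adversary may reveal only
    empty graphs: no agent then has a neighbour, so every dissimilarity cost
    vanishes, and the problem splits into independent single-agent problems.

    Let [m] be the smallest modulus and [i0] an agent attaining it. All agents
    are asked to stay at their starting points by quadratic hitting costs, until
    the last round, in which [i0] alone is pulled by a very steep quadratic
    towards a point at distance one. The direction of the pull is one of two
    opposite unit vectors, chosen so that the algorithm has not moved towards
    it; hence the algorithm pays at least almost [1/2] in the last round
    ([last_round_cost], [spike_alg_cost]).

    In hindsight [i0] approaches the target geometrically, its distance to the
    start being multiplied by [r^-1] in each round. With [r = 1 - a], where [a]
    is the positive root of [a ^+ 2 = m * (1 - a)], the cost of staying at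
    displacement [z] and then moving to [r^-1 * z] is the increment of
    [a / 2 * z ^+ 2], so that the whole approach costs [a / 2] up to a term
    decaying geometrically with the horizon ([geometric_path_cost],
    [spike_opt_cost]). Letting the horizon and the steepness tend to infinity
    yields [1 <= CR * a], and [a^-1] is the announced bound
    ([riccati_root_inv]). *)

(** * Squared norms and quadratic hitting costs *)

Lemma sqnorm2_ge0 (R : realType) (d : nat) (v : 'rV[R]_d) : 0 <= sqnorm2 v.
Proof. by apply: sumr_ge0 => k _; exact: sqr_ge0. Qed.

Lemma sqnorm2Z (R : realType) (d : nat) (c : R) (v : 'rV[R]_d) :
  sqnorm2 (c *: v) = c ^+ 2 * sqnorm2 v.
Proof.
by rewrite /sqnorm2 mulr_sumr; apply: eq_bigr => k _; rewrite mxE exprMn.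
Qed.

Lemma sqnorm2_delta (R : realType) (d : nat) (k : 'I_d) :
  sqnorm2 (delta_mx 0 k : 'rV[R]_d) = 1.
Proof.
rewrite /sqnorm2 (bigD1 k) //= big1 => [|l lk]; rewrite mxE ?eqxx /=.
  by rewrite addr0 expr1n.
by rewrite (negbTE lk) expr0n.
Qed.

Lemma sqr_coord_le_sqnorm2 (R : realType) (d : nat) (v : 'rV[R]_d) (k : 'I_d) :
  v 0 k ^+ 2 <= sqnorm2 v.
Proof.
rewrite /sqnorm2 (bigD1 k) //= lerDl.
by apply: sumr_ge0 => l _; exact: sqr_ge0.
Qed.

Definition quadratic (R : realType) (d : nat) (m : R) (c x : 'rV[R]_d) : R :=
  m / 2 * sqnorm2 (x - c).

Lemma quadratic_ge0 (R : realType) (d : nat) (m : R) (c x : 'rV[R]_d) :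
  0 <= m -> 0 <= quadratic m c x.
Proof. by move=> m0; rewrite mulr_ge0 ?divr_ge0 ?sqnorm2_ge0. Qed.

(** For the modulus [m] itself the defining inequality is an equality, and the
    slack grows with the modulus: a steeper quadratic may be revealed at will. *)
Lemma quadratic_strongly_convex (R : realType) (d : nat) (m0 m : R)
    (c : 'rV[R]_d) :
  m0 <= m -> strongly_convex m0 (quadratic m c).
Proof.
move=> m0m x y p /andP[p0 p1].
have -> : quadratic m c (p *: x + (1 - p) *: y) =
    p * quadratic m c x + (1 - p) * quadratic m c y
    - m / 2 * (p * (1 - p)) * sqnorm2 (x - y).
  rewrite /quadratic /sqnorm2 !mulr_sumr -sumrN -!big_split /=.
  by apply: eq_bigr => k _; rewrite !mxE; field.
have := sqnorm2_ge0 (x - y); have : 0 <= p * (1 - p) by nra.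
move: (sqnorm2 _) (p * (1 - p)) => S q q0 S0.
rewrite lerD2l lerN2; apply: ler_wpM2r => //; apply: ler_wpM2r => //; lra.
Qed.

(** * The scalar problem *)

(** The minimum over [u] is attained at [(M * s + w) / (M + 1)] and equals
    [M / (1 + M) * (w - s) ^+ 2 / 2]; the condition [s * w <= 0] keeps [w] at
    distance at least one from [s]. *)
Lemma last_round_cost (R : realType) (M s w u : R) :
  0 <= M -> s ^+ 2 = 1 -> s * w <= 0 ->
  2^-1 * (1 - (1 + M)^-1) <= M / 2 * (u - s) ^+ 2 + 2^-1 * (u - w) ^+ 2.
Proof.
move=> M0 s1 sw.
have M1 : 0 < 1 + M by lra.
have -> : M / 2 * (u - s) ^+ 2 + 2^-1 * (u - w) ^+ 2 =
    (1 + M) / 2 * (u - (M * s + w) / (1 + M)) ^+ 2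
    + 2^-1 * (1 - (1 + M)^-1) * (w - s) ^+ 2.
  by field; rewrite lt0r_neq0.
have i1 : (1 + M)^-1 <= 1 by rewrite invf_le1 //; lra.
have ws : 1 <= (w - s) ^+ 2 by nra.
apply: ler_wpDl; first by rewrite mulr_ge0 ?sqr_ge0 // divr_ge0 // ltW.
by rewrite ler_peMr // mulr_ge0 ?invr_ge0 // subr_ge0.
Qed.

(** The positive root of the Riccati equation [a = (m + a) / (1 + m + a)], whose
    half is the optimal cost of reaching distance one over an infinite past. *)
Definition riccati_root (R : realType) (m : R) : R :=
  2^-1 * (Num.sqrt (m ^+ 2 + 4 * m) - m).

Lemma riccati_rootP (R : realType) (m : R) : 0 < m ->
  riccati_root m ^+ 2 = m * (1 - riccati_root m).
Proof.
move=> m0; rewrite /riccati_root.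
have : Num.sqrt (m ^+ 2 + 4 * m) ^+ 2 = m ^+ 2 + 4 * m by rewrite sqr_sqrtr //; nra.
move: (Num.sqrt _) => q q2.
by rewrite exprMn sqrrB q2; field.
Qed.

Lemma riccati_root_bounds (R : realType) (m : R) : 0 < m ->
  0 < riccati_root m < 1.
Proof.
move=> m0; have := riccati_rootP m0.
have a0 : 0 < riccati_root m.
  rewrite /riccati_root mulr_gt0 // ?invr_gt0 // subr_gt0.
  by rewrite -[ltLHS](ger0_norm (ltW m0)) -sqrtr_sqr ltr_sqrt; nra.
move: (riccati_root m) a0 => a a0 aE; rewrite a0 /=; nra.
Qed.

Lemma riccati_root_inv (R : realType) (m : R) : 0 < m ->
  2^-1 + 2^-1 * Num.sqrt (1 + 4 / m) = (riccati_root m)^-1.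
Proof.
move=> m0; have /andP[a0 _] := riccati_root_bounds m0.
have aE := riccati_rootP m0.
have qE : Num.sqrt (m ^+ 2 + 4 * m) = m * Num.sqrt (1 + 4 / m).
  have -> : m ^+ 2 + 4 * m = m ^+ 2 * (1 + 4 / m) by field; rewrite lt0r_neq0.
  by rewrite sqrtrM ?sqr_ge0 // sqrtr_sqr ger0_norm // ltW.
have sE : Num.sqrt (1 + 4 / m) = 2 * riccati_root m / m + 1.
  rewrite /riccati_root qE; move: (Num.sqrt (1 + _)) => q.
  by field; rewrite lt0r_neq0.
apply: (mulIf (lt0r_neq0 a0)); rewrite mulVf ?lt0r_neq0 // sE.
move: (riccati_root m) aE => a aE.
have -> : (2^-1 + 2^-1 * (2 * a / m + 1)) * a = a + a ^+ 2 / m.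
  by field; rewrite lt0r_neq0.
by rewrite aE; field; rewrite lt0r_neq0.
Qed.

(** Displacement towards the target along the hindsight path of horizon [n.+1].
    It is forced to be null at time zero, whence a jump in the first round. *)
Definition geometric_path (R : realType) (r : R) (n t : nat) : R :=
  if t is 0 then 0 else r ^+ (n.+1 - t).

(** Since [z t = (1 - a) * z t.+1] for [1 <= t <= n], the sum of the hitting cost
    of round [t] and of the switching cost of round [t.+1] is the increment of
    [a / 2 * z t ^+ 2]; the last term is due to the initial jump. *)
Lemma geometric_path_cost (R : realType) (m a : R) (n k : nat)
    (z := geometric_path (1 - a) n) :
  a ^+ 2 = m * (1 - a) -> (k <= n)%N ->
  \sum_(1 <= t < k.+1) (m / 2 * z t ^+ 2) +
  \sum_(1 <= t < k.+2) (2^-1 * (z t - z t.-1) ^+ 2) =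
  a / 2 * z k.+1 ^+ 2 + (1 - a) / 2 * z 1%N ^+ 2.
Proof.
move=> aE; elim: k => [|k IH] kn.
  by rewrite big_geq // big_nat1 /= subr0; field.
have zk : z k.+1 = (1 - a) * z k.+2.
  by rewrite /z /= subSn // exprS.
rewrite big_nat_recr // [X in _ + X]big_nat_recr //.
rewrite [LHS]addrACA IH ?(ltnW kn) // addrAC succnK.
congr (_ + _); rewrite zk; move: (z _) => y.
have -> : a / 2 * ((1 - a) * y) ^+ 2 +
   (m / 2 * ((1 - a) * y) ^+ 2 + 2^-1 * (y - (1 - a) * y) ^+ 2) =
   2^-1 * y ^+ 2 * (a * (1 - a) ^+ 2 + (m * (1 - a)) * (1 - a) + a ^+ 2).
  by field.
by rewrite -aE; field.
Qed.

(** * The adversarial instance *)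

Definition empty_graph (N : nat) : rel 'I_N := fun _ _ => false.

Lemma empty_graph_undirected (N : nat) : undirected_graph (@empty_graph N).
Proof. by []. Qed.

Lemma dissimilarity_empty_graph (R : realType) (N d : nat)
    (s : 'M[R]_(N, d) -> R) :
  dissimilarity_cost (@empty_graph N) s -> forall x, s x = 0.
Proof. by move=> [_ s0] x; apply: s0. Qed.

Definition spike_instance (R : realType) (N d : nat) (mu : 'I_N -> R)
    (x0 : 'M[R]_(N, d)) (D : nat -> 'M[R]_(N, d) -> R) (i0 : 'I_N) (n : nat)
    (M : R) (v : 'rV[R]_d) (t : nat) : round R N d :=
  Round (fun i => if (i == i0) && (t == n.+1) then quadratic M (row i x0 + v)
                  else quadratic (mu i) (row i x0))
        (@empty_graph N) (D t).

Lemma spike_instanceP (R : realType) (N d : nat) (mu : 'I_N -> R)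
    (Dis : dissimilarity_model R N d) (x0 : 'M[R]_(N, d))
    (D : nat -> 'M[R]_(N, d) -> R) (i0 : 'I_N) (n : nat) (M : R)
    (v : 'rV[R]_d) (T : nat) :
  (forall i, 0 < mu i) -> mu i0 <= M ->
  (forall t, Dis t (@empty_graph N) (D t)) ->
  is_instance mu Dis T (spike_instance mu x0 D i0 n M v).
Proof.
move=> mu0 muM DisD t _; split => //= i.
- move=> x; case: ifP => _; apply: quadratic_ge0; last exact: ltW.
  exact: le_trans (ltW (mu0 i0)) muM.
- by case: ifP => [/andP[/eqP-> _]|_]; exact: quadratic_strongly_convex.
Qed.

(** All costs being nonnegative, only the part paid by [i0] in the last round is
    kept. *)
Lemma spike_cost_ge (R : realType) (N d : nat) (mu : 'I_N -> R)
    (beta : R) (x0 : 'M[R]_(N, d)) (D : nat -> 'M[R]_(N, d) -> R) (i0 : 'I_N)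
    (n : nat) (M : R) (v : 'rV[R]_d) (x : nat -> 'M[R]_(N, d)) :
  (forall i, 0 < mu i) -> 0 <= M -> (forall t y, D t y = 0) ->
  quadratic M (row i0 x0 + v) (row i0 (x n.+1)) +
    2^-1 * sqnorm2 (row i0 (x n.+1) - row i0 (x n)) <=
  cost beta n.+1 (spike_instance mu x0 D i0 n M v) x.
Proof.
move=> mu0 M0 D0.
have hit0 t i y : 0 <= hitting (spike_instance mu x0 D i0 n M v t) i y.
  by rewrite /=; case: ifP => _; apply: quadratic_ge0 => //; exact: ltW.
have sw0 (y : 'rV[R]_d) : 0 <= 2^-1 * sqnorm2 y.
  by rewrite mulr_ge0 ?sqnorm2_ge0 // invr_ge0.
rewrite /cost big_nat_recr //=; apply: ler_wpDl.
  apply: sumr_ge0 => t _; rewrite D0 mulr0 addr0.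
  by apply: addr_ge0; apply: sumr_ge0 => i _ //; exact: hit0.
rewrite D0 mulr0 addr0; apply: lerD.
  rewrite (bigD1 i0) //= !eqxx /= lerDl; apply: sumr_ge0 => i _.
  by have := hit0 n.+1 i (row i (x n.+1)); rewrite /= eqxx.
by rewrite (bigD1 i0) //= lerDl; apply: sumr_ge0.
Qed.

Lemma spike_cost_ge0 (R : realType) (N d : nat) (mu : 'I_N -> R)
    (beta : R) (x0 : 'M[R]_(N, d)) (D : nat -> 'M[R]_(N, d) -> R) (i0 : 'I_N)
    (n : nat) (M : R) (v : 'rV[R]_d) (x : nat -> 'M[R]_(N, d)) :
  (forall i, 0 < mu i) -> 0 <= M -> (forall t y, D t y = 0) ->
  0 <= cost beta n.+1 (spike_instance mu x0 D i0 n M v) x.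
Proof.
move=> mu0 M0 D0; apply: le_trans (spike_cost_ge _ _ _ _ _ _ mu0 M0 D0).
by rewrite addr_ge0 ?quadratic_ge0 // mulr_ge0 ?sqnorm2_ge0 // invr_ge0.
Qed.

(** The algorithm commits to its action of round [n] before the direction of the
    pull is revealed, so the adversary may choose this direction afterwards. *)
Lemma spike_trajectory_before (R : realType) (N d : nat) (mu : 'I_N -> R)
    (x0 : 'M[R]_(N, d)) (D : nat -> 'M[R]_(N, d) -> R) (i0 : 'I_N) (n : nat)
    (M : R) (v w : 'rV[R]_d) (ALG : online_algorithm R N d) (T : nat) :
  trajectory ALG x0 T (spike_instance mu x0 D i0 n M v) n =
  trajectory ALG x0 T (spike_instance mu x0 D i0 n M w) n.
Proof.
case: n => [//|n]; congr (ALG _ _); apply/eq_in_map => t.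
rewrite mem_iota => /andP[_ tn].
rewrite /spike_instance (ltn_eqF tn); congr Round; apply/funext => i.
by rewrite andbF.
Qed.

Lemma spike_alg_cost (R : realType) (N d : nat) (mu : 'I_N -> R)
    (beta : R) (x0 : 'M[R]_(N, d)) (D : nat -> 'M[R]_(N, d) -> R) (i0 : 'I_N)
    (k : 'I_d) (n : nat) (M : R) (ALG : online_algorithm R N d) :
  (forall i, 0 < mu i) -> 0 <= M -> (forall t y, D t y = 0) ->
  exists2 v : 'rV[R]_d, sqnorm2 v = 1 &
    2^-1 * (1 - (1 + M)^-1) <=
    cost beta n.+1 (spike_instance mu x0 D i0 n M v)
      (trajectory ALG x0 n.+1 (spike_instance mu x0 D i0 n M v)).
Proof.
move=> mu0 M0 D0.
pose w := trajectory ALG x0 n.+1 (spike_instance mu x0 D i0 n M 0) n i0 k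
          - x0 i0 k.
pose s : R := if w <= 0 then 1 else -1.
have s1 : s ^+ 2 = 1 by rewrite /s; case: ifP; rewrite ?sqrrN expr1n.
have sw : s * w <= 0.
  by rewrite /s; case: (leP w 0) => w0; rewrite ?mul1r // mulN1r oppr_le0 ltW.
exists (s *: delta_mx 0 k); first by rewrite sqnorm2Z sqnorm2_delta s1 mulr1.
apply: le_trans (spike_cost_ge _ _ _ _ _ _ mu0 M0 D0).
rewrite (spike_trajectory_before _ _ _ _ _ _ _ 0) /quadratic.
move: (trajectory _ _ _ _ n.+1) => X.
apply: le_trans (last_round_cost (X i0 k - x0 i0 k) M0 s1 sw) _.
apply: lerD; apply: ler_wpM2l; rewrite ?divr_ge0 ?invr_ge0 //.
  apply: le_trans (sqr_coord_le_sqnorm2 _ k).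
  by rewrite !mxE !eqxx mulr1 opprD addrA.
apply: le_trans (sqr_coord_le_sqnorm2 _ k).
by rewrite !mxE /w opprB addrA subrK.
Qed.

Lemma spike_opt_cost_ge0 (R : realType) (N d : nat) (mu : 'I_N -> R)
    (beta : R) (x0 : 'M[R]_(N, d)) (D : nat -> 'M[R]_(N, d) -> R) (i0 : 'I_N)
    (n : nat) (M : R) (v : 'rV[R]_d) :
  (forall i, 0 < mu i) -> 0 <= M -> (forall t y, D t y = 0) ->
  0 <= opt_cost beta x0 n.+1 (spike_instance mu x0 D i0 n M v).
Proof.
move=> mu0 M0 D0; apply: lb_le_inf.
  by eexists; exists (fun=> x0).
by move=> _ [x _ <-]; exact: spike_cost_ge0.
Qed.

(** In hindsight only [i0] moves, along the geometric path; it is on target in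
    the last round, so that the bound does not depend on the steepness [M]. *)
Lemma spike_opt_cost (R : realType) (N d : nat) (mu : 'I_N -> R)
    (beta : R) (x0 : 'M[R]_(N, d)) (D : nat -> 'M[R]_(N, d) -> R) (i0 : 'I_N)
    (n : nat) (M : R) (v : 'rV[R]_d) (a := riccati_root (mu i0)) :
  (forall i, 0 < mu i) -> 0 <= M -> (forall t y, D t y = 0) ->
  sqnorm2 v = 1 ->
  opt_cost beta x0 n.+1 (spike_instance mu x0 D i0 n M v) <=
  a / 2 + (1 - a) / 2 * ((1 - a) ^+ 2) ^+ n.
Proof.
move=> mu0 M0 D0 v1.
pose z := geometric_path (1 - a) n.
pose c i t := if i == i0 then z t else 0.
pose x t := \matrix_(i < N, j < d) (x0 i j + c i t * v 0 j).
have rowx t i : row i (x t) = row i x0 + c i t *: v.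
  by apply/rowP => j; rewrite !mxE.
have v0 : sqnorm2 (0 : 'rV[R]_d) = 0.
  by rewrite -(scale0r v) sqnorm2Z expr0n mul0r.
have hitE t : \sum_(i < N) hitting (spike_instance mu x0 D i0 n M v t) i
      (row i (x t)) = if t == n.+1 then 0 else mu i0 / 2 * z t ^+ 2.
  rewrite (bigD1 i0) //= big1 => [|i ii0]; last first.
    rewrite (negbTE ii0) /= /quadratic rowx /c (negbTE ii0) addrC addKr.
    by rewrite scale0r v0 mulr0.
  rewrite addr0 eqxx /= rowx /c eqxx; case: ifP => [/eqP->|_].
    by rewrite /quadratic /z /= subnn expr0 scale1r subrr v0 mulr0.
  by rewrite /quadratic addrC addKr sqnorm2Z v1 mulr1.
have swE t : \sum_(i < N) 2^-1 * sqnorm2 (row i (x t) - row i (x t.-1)) =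
    2^-1 * (z t - z t.-1) ^+ 2.
  have rowB i : row i (x t) - row i (x t.-1) = (c i t - c i t.-1) *: v.
    by rewrite !rowx opprD addrACA subrr add0r scalerBl.
  rewrite (bigD1 i0) //= big1 => [|i ii0]; last first.
    by rewrite rowB /c (negbTE ii0) subrr scale0r v0 mulr0.
  by rewrite addr0 rowB /c eqxx sqnorm2Z v1 mulr1.
have xE : cost beta n.+1 (spike_instance mu x0 D i0 n M v) x =
    a / 2 + (1 - a) / 2 * ((1 - a) ^+ 2) ^+ n.
  rewrite /cost; under eq_bigr => t _ do
    rewrite hitE swE [dissimilarity _ _]D0 mulr0 addr0.
  rewrite big_split /= [X in X + _]big_nat_recr //= eqxx addr0.
  have := geometric_path_cost (riccati_rootP (mu0 i0)) (leqnn n).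
  rewrite -/a -/z.
  have -> : \sum_(1 <= t < n.+1) (if t == n.+1 then 0 else mu i0 / 2 * z t ^+ 2)
     = \sum_(1 <= t < n.+1) (mu i0 / 2 * z t ^+ 2).
    by apply: eq_big_nat => t /andP[_ tn]; rewrite (ltn_eqF tn).
  move=> ->; rewrite /z /= subnn subSS subn0 expr0 expr1n mulr1.
  by rewrite -!exprM mulnC.
rewrite -xE; apply: ge_inf.
  by exists 0 => _ [y _ <-]; exact: spike_cost_ge0.
exists x => //; apply/matrixP => i j; rewrite mxE /c /z /=.
by case: ifP; rewrite mul0r addr0.
Qed.

(** * Letting the horizon grow *)

(** Replacing [CR] by [Num.max CR 0] makes it possible to bound the optimal cost
    from above while the sign of [CR] is still unknown. *)
Lemma spike_ratio (R : realType) (N d : nat) (hd : (0 < d)%N)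
    (mu : 'I_N -> R) (beta : R) (Dis : dissimilarity_model R N d)
    (x0 : 'M[R]_(N, d)) (ALG : online_algorithm R N d) (CR : R) (i0 : 'I_N)
    (a := riccati_root (mu i0)) :
  (forall i, 0 < mu i) ->
  (forall t, Dis t (@empty_graph N) !=set0) ->
  (forall t s, Dis t (@empty_graph N) s ->
     dissimilarity_cost (@empty_graph N) s) ->
  has_competitive_ratio mu beta Dis x0 ALG CR ->
  1 <= Num.max CR 0 * a.
Proof.
move=> mu0 Dis0 DisC [eps [eps0 ratio]].
have [D DisD] := choice Dis0.
have D0 t y : D t y = 0 by apply: dissimilarity_empty_graph; exact: (DisC t).
have /andP[a0 a1] := riccati_root_bounds (mu0 i0); rewrite -/a in a0 a1.
pose C := Num.max CR 0.
have C0 : 0 <= C by rewrite le_max lexx orbT.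
have step n : 2^-1 * (1 - harmonic n) <=
    C * (a / 2 + (1 - a) / 2 * ((1 - a) ^+ 2) ^+ n) + eps n.+1.
  (* The steepness grows with the horizon, so that [(1 + M)^-1] tends to zero. *)
  pose M := mu i0 + n%:R.
  have M0 : 0 <= M by rewrite addr_ge0 // ltW.
  have [v v1 algv] :=
    spike_alg_cost beta x0 i0 (Ordinal hd) n ALG mu0 M0 D0.
  have inst := @spike_instanceP _ _ _ _ Dis x0 D i0 n M v n.+1 mu0 _ DisD.
  have := ratio n.+1 _ (inst _); rewrite lerDl => /(_ (ler0n _ _)) ratv.
  apply: le_trans (le_trans _ algv) (le_trans ratv _).
    rewrite ler_wpM2l ?invr_ge0 // lerD2l lerN2 /harmonic /=.
    rewrite lef_pV2 ?posrE ?ltr0n //; last by lra.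
    by rewrite -natr1 addrC lerD2l lerDr ltW.
  have opt0 := spike_opt_cost_ge0 beta x0 i0 n v mu0 M0 D0.
  rewrite lerD2r.
  apply: le_trans (ler_wpM2l C0 (spike_opt_cost _ _ _ _ mu0 M0 D0 v1)).
  by apply: ler_wpM2r => //; rewrite le_max lexx.
have cvl : 2^-1 * (1 - harmonic n) @[n --> \oo] --> (2^-1 * (1 - 0) : R).
  by apply: cvgMr; apply: cvgB; [exact: cvg_cst|exact: cvg_harmonic].
have cvr : C * (a / 2 + (1 - a) / 2 * ((1 - a) ^+ 2) ^+ n) + eps n.+1
    @[n --> \oo] --> C * (a / 2 + (1 - a) / 2 * 0) + 0.
  apply: cvgD; last by rewrite (cvg_shiftS eps).
  apply: cvgMr; apply: cvgD; first exact: cvg_cst.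
  apply: cvgMr; apply: cvg_expr.
  by rewrite ger0_norm ?sqr_ge0 // expr_lt1 //; lra.
have lim : 2^-1 * (1 - 0) <= C * (a / 2 + (1 - a) / 2 * 0) + 0.
  exact: ler_cvg_to cvl cvr (nearW _ step).
by rewrite -/C; lra.
Qed.

Theorem theorem3p3 (R : realType) (N d : nat) (hN : (0 < N)%N) (hd : (0 < d)%N)
    (mu : 'I_N -> R) (hmu : forall i, 0 < mu i)
    (beta : R) (hbeta : 0 < beta)
    (Dis : dissimilarity_model R N d)
    (hDis0 : forall t G, undirected_graph G -> Dis t G !=set0)
    (hDis : forall t G s, undirected_graph G -> Dis t G s ->
       dissimilarity_cost G s)
    (hconv : forall t G s, undirected_graph G -> Dis t G s -> convex_cost s)
    (x0 : 'M[R]_(N, d)) (ALG : online_algorithm R N d) (CR : R)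
    (hCR : has_competitive_ratio mu beta Dis x0 ALG CR) :
  2^-1 + 2^-1 * Num.sqrt (1 + 4 / \big[Num.min/mu (Ordinal hN)]_(i < N) mu i)
    <= CR.
Proof.
have [i0 <-] : exists i0, mu i0 = \big[Num.min/mu (Ordinal hN)]_(i < N) mu i.
  apply: (big_ind (fun y => exists i, mu i = y)) => [|y z [i <-] [j <-]|i _].
  - by exists (Ordinal hN).
  - by rewrite /Num.min; case: ifP; [exists i|exists j].
  - by exists i.
have := spike_ratio hd i0 hmu (fun t => hDis0 t _ (@empty_graph_undirected N))
  (fun t s => hDis t _ s (@empty_graph_undirected N)) hCR.
have /andP[a0 _] := riccati_root_bounds (hmu i0).
rewrite riccati_root_inv // -[_^-1]mul1r ler_pdivrMr //.
case: (leP CR 0) => // _; rewrite mul0r; lra.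
Qed.
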